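(* Let $B$ be a symmetric matrix over a field of characteristic $2$, with $\operatorname{epr}(B)=\ell_1\ell_2\cdots\ell_n$. Suppose $\ell_k=\mathtt{N}$ with $k$ even. Then $\ell_j=\mathtt{N}$ for all $j\geq k$ (with $j\le n$).
   Context: For an $n\times n$ symmetric matrix $B$ over a field $\mathbb{F}$, the enhanced principal rank characteristic sequence (epr-sequence) is $\operatorname{epr}(B)=\ell_1\ell_2\cdots\ell_n$, where $\ell_k=\mathtt{A}$ if all principal minors of $B$ of order $k$ are nonzero, $\ell_k=\mathtt{S}$ if some but not all principal minors of order $k$ are nonzero, and $\ell_k=\mathtt{N}$ if all principal minors of order $k$ are zero. *)

(* Defs.v *)
From mathcomp Require Import all_boot all_algebra.

Set Implicit Arguments.
Unset Strict Implicit.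
Unset Printing Implicit Defensive.

Local Open Scope ring_scope.

Inductive epr_letter : Type := letterA | letterS | letterN.

(* [enum_val : 'I_#|I| -> 'I_n] lists the elements of [I] in increasing order,
   so this is the determinant of the submatrix B[I] with rows and columns
   indexed by [I], a principal minor of order [#|I|]. *)
Definition principal_minor (F : fieldType) (n : nat) (B : 'M[F]_n)
    (I : {set 'I_n}) : F :=
  \det (mxsub (@enum_val _ (mem I)) (@enum_val _ (mem I)) B).

(* Meaningful for 1 <= k <= n only: for k > n there is no principal minor of
   order k, and the first test holds vacuously. *)
Definition epr_term (F : fieldType) (n : nat) (B : 'M[F]_n) (k : nat) :
    epr_letter :=
  if [forall (I : {set 'I_n} | #|I| == k), principal_minor B I != 0]
  then letterA
  else if [exists (I : {set 'I_n} | #|I| == k), principal_minor B I != 0]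
  then letterS
  else letterN.

Definition epr (F : fieldType) (n : nat) (B : 'M[F]_n) : seq epr_letter :=
  [seq epr_term B k | k <- iota 1 n].

(* Main.v *)
Require Import Defs.
From mathcomp Require Import all_boot all_algebra all_fingroup.

(** Let k be even and suppose that every principal minor of order k vanishes.
If C is a principal submatrix of order k+1, its adjugate is symmetric with
zero diagonal, hence alternating of odd order, hence singular; so C is
singular.  If C is principal of order k+2, its adjugate is again alternating
by the previous case; by Jacobi's complementary minor identity a nonzero entry
(i, j) of it would make the minor of C on the complement of {i, j} nonzero
when C is invertible.  So the adjugate is zero and C is singular.  Induction
on k in steps of 2 concludes. *)

Set Implicit Arguments.
Unset Strict Implicit.

Local Open Scope ring_scope.

Import GRing.Theory.

(** Points moved by [h] pair off into orbits of size 2 with equal values, which cancel in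
    characteristic 2. *)
Lemma sum_involution_pchar2 (R : nzRingType) (char2 : 2%N \in [pchar R])
    (T : finType) (h : T -> T) (f : T -> R) :
    involutive h -> (forall x, f (h x) = f x) ->
    (forall x, h x = x -> f x = 0) ->
  \sum_x f x = 0.
Proof.
move=> hK fh f0.
(* The order on ranks selects one representative of each orbit of size 2. *)
rewrite (bigID (fun x => enum_rank x < enum_rank (h x))%N) /=.
rewrite [X in _ + X](bigID (fun x => h x == x)) /=.
rewrite [X in _ + (X + _)]big1 ?add0r; last by move=> x /andP[_ /eqP /f0].
rewrite [X in _ + X](reindex_inj (can_inj hK)) /=.
rewrite [X in _ + X](eq_big (fun x => enum_rank x < enum_rank (h x))%N f).
- exact: (addrr_pchar2 char2).
- move=> x; rewrite hK -leqNgt ltn_neqAle andbC; congr (_ && _).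
  by rewrite (inj_eq val_inj) (inj_eq enum_rank_inj).
- by move=> x _.
Qed.

(** In the Leibniz sum, symmetry of [A] gives [s] and its inverse equal terms. If [s] is its own
    inverse, it fixes a point because [m] is odd, so its term contains a zero diagonal entry. *)
Lemma det_alternating_odd (R : comNzRingType) (char2 : 2%N \in [pchar R])
    (m : nat) (A : 'M[R]_m) :
  odd m -> A^T = A -> (forall i, A i i = 0) -> \det A = 0.
Proof.
move=> odd_m symA diagA; apply: (sum_involution_pchar2 char2 (h := invg)).
- exact: invgK.
- move=> s; rewrite odd_permV (reindex_inj (@perm_inj _ s)) /=.
  congr (_ * _); apply: eq_bigr => i _.
  by rewrite permK -[in LHS]symA mxE.
- move=> s sV.
  case: (pickP (fun i => s i == i)) => [i /eqP si | no_fix].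
    by rewrite (bigD1 i) //= si diagA mul0r mulr0.
  (* A fixed-point-free involution [s] would make [m] vanish in [R], hence even. *)
  have : \sum_(i < m) (1 : R) = 0.
    apply: (sum_involution_pchar2 char2 (h := s)) => // i.
      by rewrite -{1}sV permK.
    by move/eqP; rewrite no_fix.
  move/eqP; rewrite sumr_const card_ord -(dvdn_pcharf char2) dvdn2.
  by rewrite odd_m.
Qed.

(** Injections, unlike sets, compose, so passing to a submatrix of a submatrix is immediate. *)
Definition minors_vanish (F : fieldType) (n : nat) (B : 'M[F]_n) (k : nat) :
    Prop :=
  forall f : 'I_k -> 'I_n, injective f -> \det (mxsub f f B) = 0.

Lemma minors_vanish_mxsub (F : fieldType) (n m k : nat) (B : 'M[F]_n)
    (g : 'I_m -> 'I_n) :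
  injective g -> minors_vanish B k -> minors_vanish (mxsub g g B) k.
Proof.
move=> g_inj B0 f f_inj.
have -> : mxsub f f (mxsub g g B) = mxsub (g \o f) (g \o f) B.
  by apply/matrixP => i j; rewrite !mxE.
exact/B0/inj_comp.
Qed.

Lemma mxsub_sym (F : fieldType) (n m : nat) (B : 'M[F]_n) (g : 'I_m -> 'I_n) :
  B^T = B -> (mxsub g g B)^T = mxsub g g B.
Proof. by move=> symB; apply/matrixP => i j; rewrite !mxE -[in LHS]symB mxE. Qed.

Lemma adj_diag0 (F : fieldType) (k : nat) (C : 'M[F]_k.+1) (i : 'I_k.+1) :
  minors_vanish C k -> (\adj C) i i = 0.
Proof.
move=> C0; rewrite mxE /cofactor.
have -> : row' i (col' i C) = mxsub (lift i) (lift i) C.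
  by apply/matrixP => a b; rewrite !mxE.
by rewrite C0 ?mulr0 //; apply: lift_inj.
Qed.

(** Taking determinants in [C *m \adj C = (\det C)%:M] gives [\det C ^+ m = 0]. *)
Lemma det0_adj (F : fieldType) (m : nat) (C : 'M[F]_m) :
  \det (\adj C) = 0 -> \det C = 0.
Proof.
move=> adj0; have := congr1 determinant (mul_mx_adj C).
rewrite det_mulmx adj0 mulr0 det_scalar => /esym/eqP.
by rewrite expf_eq0 => /andP[_ /eqP].
Qed.

Lemma minors_vanishS (F : fieldType) (char2 : 2%N \in [pchar F]) (n k : nat)
    (B : 'M[F]_n) :
  B^T = B -> ~~ odd k -> minors_vanish B k -> minors_vanish B k.+1.
Proof.
move=> symB even_k B0 g g_inj; apply/det0_adj/(det_alternating_odd char2) => //.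
  by rewrite trmx_adj mxsub_sym.
by move=> i; apply/adj_diag0/minors_vanish_mxsub.
Qed.

(* The case of Jacobi's identity that is needed: a null vector v of the
submatrix of C on the complement of {i, j}, extended by 0 to x, has xC
supported on {i, j}, and x is recovered from xC by the adjugate. *)
Lemma adj_offdiag0 (F : fieldType) (k : nat) (C : 'M[F]_k.+2)
    (i : 'I_k.+2) (j' : 'I_k.+1) (j := lift i j') :
    \det C != 0 -> minors_vanish C k -> C^T = C ->
    (forall a, (\adj C) a a = 0) ->
  (\adj C) i j = 0.
Proof.
move=> detC C0 symC diag0; pose f := lift i \o lift j'.
have f_inj : injective f by apply: inj_comp; apply: lift_inj.
have fNi a : f a != i by rewrite eq_sym neq_lift.
have fNj a : f a != j by rewrite (inj_eq lift_inj) eq_sym neq_lift.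
have f_cases b : [\/ b = i, b = j | exists a, b = f a].
  case: (unliftP i b) => [b' -> | ->]; last exact: Or31.
  case: (unliftP j' b') => [a -> | ->]; last exact: Or32.
  by apply: Or33; exists a.
have /eqP/det0P[v v_neq0 vC0] := C0 f f_inj.
pose P : 'M[F]_(k, k.+2) := rowsub f 1%:M.
have PE a b : P a b = (f a == b)%:R by rewrite !mxE.
pose x := v *m P; pose y := x *m C.
have x0 b : (forall a, f a != b) -> x 0 b = 0.
  move=> fNb; rewrite mxE big1 // => a _.
  by rewrite PE (negPf (fNb a)) mulr0.
have xf a : x 0 (f a) = v 0 a.
  rewrite mxE (bigD1 a) //= PE eqxx mulr1 big1 ?addr0 // => b b_neq.
  by rewrite PE (inj_eq f_inj) (negPf b_neq) mulr0.
have yf a : y 0 (f a) = 0.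
  have <- : (v *m mxsub f f C) 0 a = y 0 (f a).
    have -> : mxsub f f C = P *m colsub f C.
      by rewrite /P mul_rowsub_mx mul1mx; apply/matrixP=> b c; rewrite !mxE.
    rewrite mulmxA -/x !mxE.
    by apply: eq_bigr => b _; rewrite !mxE.
  by rewrite vC0 mxE.
have yA b : y 0 i * (\adj C) i b + y 0 j * (\adj C) j b = x 0 b * \det C.
  have -> : x 0 b * \det C = (y *m \adj C) 0 b.
    by rewrite /y -mulmxA mul_mx_adj mul_mx_scalar [RHS]mxE mulrC.
  rewrite [RHS]mxE (bigD1 i) //= (bigD1 j) /=; last by rewrite eq_sym neq_lift.
  rewrite big1 ?addr0 // => c /andP[cNi cNj].
  have [ci | cj | [a ->]] := f_cases c; last by rewrite yf mul0r.
    by rewrite ci eqxx in cNi.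
  by rewrite cj eqxx in cNj.
have adj_sym a b : (\adj C) a b = (\adj C) b a.
  by rewrite -[in LHS]symC -trmx_adj mxE.
(* At [b = j] and [b = i] both [x] and a diagonal entry of the adjugate vanish in [yA], so a nonzero
   [(i, j)] entry forces [y = 0], hence [v = 0]. *)
apply/eqP/negPn/negP => Aij.
have yj : y 0 j = 0.
  have /eqP := yA i; rewrite diag0 mulr0 add0r x0 // mul0r mulf_eq0 adj_sym.
  by rewrite (negPf Aij) orbF => /eqP.
have yi : y 0 i = 0.
  have /eqP := yA j; rewrite diag0 mulr0 addr0 x0 // mul0r mulf_eq0.
  by rewrite (negPf Aij) orbF => /eqP.
case/eqP: v_neq0; apply/rowP => a; rewrite -xf [RHS]mxE; apply/eqP.
have /esym/eqP := yA (f a).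
by rewrite yi yj !mul0r addr0 mulf_eq0 (negPf detC) orbF.
Qed.

Lemma minors_vanishSS (F : fieldType) (n k : nat) (B : 'M[F]_n) :
    B^T = B -> minors_vanish B k -> minors_vanish B k.+1 ->
  minors_vanish B k.+2.
Proof.
move=> symB Bk Bk1 g g_inj; set C := mxsub g g B.
have diag0 a : (\adj C) a a = 0 by apply/adj_diag0/minors_vanish_mxsub.
case: (eqVneq (\det C) 0) => // detC; case/eqP: (detC); apply: det0_adj.
suff -> : \adj C = 0 by rewrite det0.
apply/matrixP => i j; rewrite [RHS]mxE.
case: (unliftP i j) => [j' -> | -> //].
apply: adj_offdiag0 => //; first exact: minors_vanish_mxsub.
exact: mxsub_sym.
Qed.

Lemma minors_vanish_geq (F : fieldType) (char2 : 2%N \in [pchar F])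
    (n k j : nat) (B : 'M[F]_n) :
    B^T = B -> ~~ odd k -> minors_vanish B k -> (k <= j)%N ->
  minors_vanish B j.
Proof.
move=> symB even_k Bk le_kj.
have even_case m : minors_vanish B (m.*2 + k).
  elim: m => // m IHm; rewrite doubleS !addSn; apply: minors_vanishSS => //.
  by apply: minors_vanishS => //; rewrite oddD odd_double.
(* Steps of 2 reach every even order; an odd [j] takes one more step of 1. *)
rewrite -(subnK le_kj) -[(j - k)%N]odd_double_half -addnA.
case: odd; rewrite /= ?add0n ?add1n //; apply: minors_vanishS => //.
by rewrite oddD odd_double.
Qed.

(** Rows and columns undergo the same permutation, so its sign occurs twice and cancels. *)
Lemma det_mxsub_reorder (F : fieldType) (n k : nat) (B : 'M[F]_n)
    (f g : 'I_k -> 'I_n) (s : 'I_k -> 'I_k) :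
    injective f -> (forall x, g (s x) = f x) ->
  \det (mxsub f f B) = \det (mxsub g g B).
Proof.
move=> f_inj gs.
have s_inj : injective s by move=> x y sxy; apply: f_inj; rewrite -!gs sxy.
have -> : mxsub f f B = row_perm (perm s_inj) (col_perm (perm s_inj) (mxsub g g B)).
  by apply/matrixP => i j; rewrite !mxE !permE !gs.
rewrite row_permE col_permE !det_mulmx !det_perm odd_permV mulrCA.
by rewrite -signr_addb addbb mulr1.
Qed.

Lemma minors_vanishP (F : fieldType) (n k : nat) (B : 'M[F]_n) :
  minors_vanish B k <->
  (forall I : {set 'I_n}, #|I| = k -> principal_minor B I = 0).
Proof.
split=> [B0 I cardI | B0 f f_inj].
  by move: B0; rewrite -cardI => B0; apply/B0/enum_val_inj.
pose I := [set f x | x : 'I_k].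
have cardI : #|I| = k by rewrite card_imset // card_ord.
have memI x : f x \in I by apply: imset_f.
(* Abstracting [enum_val] to [g] lets [#|I|] be rewritten to [k] in its type. *)
have s_exists (g : 'I_#|I| -> 'I_n) : (forall y, y \in I -> exists x, g x = y) ->
    \det (mxsub g g B) = 0 -> \det (mxsub f f B) = 0.
  move: g; rewrite cardI => g g_onto gB0.
  have /fin_all_exists[s gs] x : exists y, g y = f x by apply: g_onto.
  by rewrite (det_mxsub_reorder B f_inj gs).
apply: (s_exists (@enum_val _ (mem I))) (B0 I cardI) => y yI.
by exists (enum_rank_in yI y); rewrite enum_rankK_in.
Qed.

Lemma epr_term_NP (F : fieldType) (n k : nat) (B : 'M[F]_n) :
  (k <= n)%N -> epr_term B k = letterN <-> minors_vanish B k.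
Proof.
move=> le_kn; apply: iff_trans (iff_sym (minors_vanishP k B)).
rewrite /epr_term; split.
  case: ifP => // _; case: ifP => // /negbT/existsPn noI _ I /eqP cardI.
  by apply/eqP; move: (noI I); rewrite cardI negbK.
move=> B0; rewrite ifF ?ifF //.
  by apply/existsP => -[I /andP[/eqP /B0 ->]]; rewrite eqxx.
(* A set of size [k], available since [k <= n], rules out a vacuous [letterA]. *)
apply/negP => /forallP allI.
pose I := [set widen_ord le_kn x | x : 'I_k].
have cardI : #|I| = k.
  by rewrite card_imset ?card_ord // => x y /(congr1 val) /= /val_inj.
by have := allI I; rewrite cardI eqxx B0 ?eqxx.
Qed.

Theorem mainTheorem5 (F : fieldType) (charF2 : 2%N \in [pchar F])
    (n : nat) (B : 'M[F]_n) (symB : B^T = B)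
    (l : nat -> epr_letter) (eprB : epr B = [seq l i | i <- iota 1 n])
    (k : nat) (k_range : (1 <= k <= n)%N) (k_even : ~~ odd k)
    (lkN : l k = letterN) :
  forall j : nat, (k <= j <= n)%N -> l j = letterN.
Proof.
have lE i : (1 <= i <= n)%N -> l i = epr_term B i.
  case: i => // i /= lt_in; have := congr1 (fun s => nth letterN s i) eprB.
  by rewrite /epr !(nth_map 0%N) ?size_iota // nth_iota // add1n.
move=> j /andP[le_kj le_jn]; case/andP: (k_range) => k_gt0 le_kn.
rewrite lE ?le_jn ?(leq_trans k_gt0) //; apply/epr_term_NP => //.
apply: (minors_vanish_geq charF2 symB k_even) => //.
by apply/epr_term_NP; rewrite -?lE.
Qed.
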